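(* Let $\varepsilon\ge0$. A mechanism $M$ on $\mathsf{X}$ is $(1,\varepsilon)$-RDP if and only if $M$ is $(L,\mathcal{H},\mathrm{id},\varepsilon)$-PPE, where $\mathrm{id}(s)=s$.
   Context: $(\mathsf{X},\mathcal{X})$ is a measurable space of datasets with $\{x\}\in\mathcal{X}$ for all $x$. A mechanism $M$ is a Markov kernel from $\mathsf{X}$ to a measurable output space; $\mathbb{E}_x$ denotes expectation under $T\sim M(x,\cdot)$. A symmetric binary neighbour relation $\sim$ on $\mathsf{X}$ is fixed. Rényi DP with $\alpha=1$: $M$ is $(1,\varepsilon)$-RDP if $\sup_{x\sim x'}D_1[M(x',\cdot)\Vert M(x,\cdot)]\le\varepsilon$, where $D_1[P\Vert P']=\mathbb{E}_{X\sim P}\left[\log\frac{\mathrm{d}P}{\mathrm{d}P'}(X)\right]$ is the Kullback--Leibler divergence ($+\infty$ if $P$ is not absolutely continuous with respect to $P'$). Priors: $\mathcal{P}_2$ is the set of probability measures $Q=\sum_{z\in\mathsf{Z}}w_z\delta_z$ with $\mathsf{Z}\subset\mathsf{X}$, $|\mathsf{Z}|=2$, $w_z>0$, $\sum_zw_z=1$, and $\mathcal{H}=\{Q\in\mathcal{P}_2:\exists z\sim z',\ Q(\{z,z'\})=1\}$. Score: $L(Q,x)=-\log Q(\{x\})$ with $\log0=-\infty$. Posterior: $Q_T$ is the Bayes posterior of $Q$ after observing $T$. For $Q\in\mathcal{H}$ with support $\{x,x'\}$, $w=Q(\{x\})\in(0,1)$, and $m(x,\cdot),m(x',\cdot)$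 densities of $M(x,\cdot),M(x',\cdot)$ with respect to a common dominating measure, $Q_T(\{x\})=\frac{m(x,T)w}{m(x,T)w+m(x',T)(1-w)}$; if $Q(\{x\})=0$ then $Q_T(\{x\})=0$. Persuasive privacy in expectation: for a score $S$, class of priors $\mathcal{Q}$, function $g$ and $\kappa\ge0$, $M$ is $(S,\mathcal{Q},g,\kappa)$-PPE if $$\sup_{x\in\mathsf{X}}\sup_{Q\in\mathcal{Q}}\mathbb{E}_x\left[g\{\Delta_S(Q,T,x)\}\right]\le\kappa,\qquad\Delta_S(Q,T,x)=S(Q,x)-S(Q_T,x),$$ with the convention $\infty-\infty=0$. *)

(* Defs.v *)
From HB Require Import structures.
From mathcomp Require Import all_boot all_order all_algebra.
From mathcomp Require Import all_classical all_reals all_analysis.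
Set Implicit Arguments.
Unset Strict Implicit.
Unset Printing Implicit Defensive.
Import Order.TTheory GRing.Theory Num.Theory.
Import numFieldNormedType.Exports.
Local Open Scope classical_set_scope.
Local Open Scope ring_scope.
Local Open Scope ereal_scope.
Local Open Scope charge_scope.

(* [k x] only carries the structure of a measure; [kernel_at k x] is the same
   set function, as a probability. *)
Section KernelAt.
Context {d d' : measure_display}.
Context {T : measurableType d} {T' : measurableType d'} {R : realType}.
Variables (k : R.-pker T ~> T') (x : T).

Definition kernel_at : set T' -> \bar R := k x.

HB.instance Definition _ := Measure.on kernel_at.

Let kernel_at_setT : kernel_at setT = 1.
Proof. exact: prob_kernel. Qed.

HB.instance Definition _ :=
  Measure_isProbability.Build _ _ _ kernel_at kernel_at_setT.

End KernelAt.

Section Divergence.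
Context {d : measure_display} {Y : measurableType d} {R : realType}.

(* Kullback-Leibler divergence, i.e. Renyi divergence of order 1. *)
Definition KL (P P' : probability Y R) : \bar R :=
  if `[< P `<< P' >]
  then \int[P]_t lne (('d (charge_of_finite_measure P) '/d P') t)
  else +oo.

(* [m] is a real-valued version of dP/dmu. *)
Definition is_density (mu : {measure set Y -> \bar R}) (P : probability Y R)
    (m : Y -> R) : Prop :=
  [/\ measurable_fun setT m, (forall t, (0 <= m t)%R) &
      forall A, measurable A -> P A = \int[mu]_(t in A) (m t)%:E].

End Divergence.

Section Privacy.
Context {dX dY : measure_display}.
Context {X : measurableType dX} {Y : measurableType dY} {R : realType}.
Variable M : R.-pker X ~> Y.

(* Renyi differential privacy of order 1. *)
Definition RDP1 (nbr : X -> X -> Prop) (eps : R) : Prop :=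
  ereal_sup [set D | exists x x', nbr x x' /\ D = KL (kernel_at M x') (kernel_at M x)] <= eps%:E.

(* [QT] is a version of the posterior map t |-> Q_t of a two-point prior [Q].
   Bayes' formula is required wherever its denominator is positive: where the
   denominator vanishes, a null set for both M x and M x', the formula is 0/0
   and [QT t] may be any probability not charging the points outside the
   support of [Q]. *)
Definition is_posterior (Q : probability X R) (QT : R.-pker Y ~> X) : Prop :=
  (exists (x x' : X) (mu : {sigma_finite_measure set Y -> \bar R})
      (m m' : Y -> R),
    let w := fine (Q [set x]) in
    [/\ (0 < w < 1)%R, Q [set x; x'] = 1,
        is_density mu (kernel_at M x) m,
        is_density mu (kernel_at M x') m' &
        forall t, let c := (m t * w + m' t * (1 - w))%R in
          (0 < c)%R ->
          QT t [set x] = (m t * w / c)%:E /\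
          QT t [set x'] = (m' t * (1 - w) / c)%:E]) /\
  (forall y, Q [set y] = 0 -> forall t, QT t [set y] = 0).

Definition score_gap (S : probability X R -> X -> \bar R)
    (Q Q' : probability X R) (x : X) : \bar R :=
  (* In [\bar R] the library sets +oo - +oo = -oo; here it must be 0. *)
  if S Q x == S Q' x then 0 else S Q x - S Q' x.

(* The supremum also ranges over all versions of the posterior, which agree
   M x-a.s. on [set x] for every x in the support of [Q] and everywhere outside
   of it. As [is_posterior] only describes posteriors of two-point priors,
   [priors] should consist of such priors. *)
Definition PPE (S : probability X R -> X -> \bar R)
    (priors : set (probability X R)) (g : \bar R -> \bar R) (kappa : R)
    : Prop :=
  ereal_sup [set e | exists (x : X) (Q : probability X R) (QT : R.-pker Y ~> X),
    [/\ priors Q, is_posterior Q QT &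
        e = \int[M x]_t g (score_gap S Q (kernel_at QT t) x)]] <= kappa%:E.

End Privacy.

Section Priors.
Context {d : measure_display} {X : measurableType d} {R : realType}.

Definition two_point_priors : set (probability X R) :=
  [set Q | exists (z z' : X) (w w' : R),
    [/\ z <> z', (0 < w)%R, (0 < w')%R, (w + w' = 1)%R &
        forall A, measurable A -> Q A = w%:E * \d_z A + w'%:E * \d_z' A]].

Definition neighbour_priors (nbr : X -> X -> Prop) : set (probability X R) :=
  [set Q | two_point_priors Q /\
     exists z z', nbr z z' /\ Q [set z; z'] = 1].

Definition log_score (Q : probability X R) (x : X) : \bar R :=
  - lne (Q [set x]).

End Priors.

(* Main.v *)
Require Import Defs.
From HB Require Import structures.
From mathcomp Require Import all_boot all_order all_algebra.
From mathcomp Require Import all_classical all_reals all_analysis.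
From mathcomp Require Import measurable_realfun ring lra.
Set Implicit Arguments.
Unset Strict Implicit.
Unset Printing Implicit Defensive.
Import Order.TTheory GRing.Theory Num.Theory.
Import numFieldNormedType.Exports.
Local Open Scope classical_set_scope.
Local Open Scope ring_scope.
Local Open Scope ereal_scope.
Local Open Scope charge_scope.

(** Let [P = M x] and [P' = M x'] have densities [m] and [m'], put [r = m' / m],
    and let a two-point prior give weight [w] to [x] and [1 - w] to [x'].  Bayes'
    formula turns the score gap at [x] into [- ln (w + (1 - w) * r)], [P]-almost
    surely ([expected_log_score_gap]): the expected gap is the divergence of [P]
    from the mixture [w P + (1 - w) P'].  The theorem therefore says that
    [KL P P' <= eps] if and only if the divergence of [P] from each such mixture
    is at most [eps].

    If [KL P P' <= eps], concavity of [ln] gives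
    [- ln (w + (1 - w) * r) <= (1 - w) * - ln r], so the mixture divergence is at
    most [(1 - w) * eps <= eps] ([mixture_divergence_le]).

    Conversely, let [w] tend to [0]: the integrand tends to [- lne r], whose
    integral is [KL P P'].  Fatou's lemma applies because adding [r], whose
    integral is at most [P' setT = 1], makes the integrands nonnegative.  The
    value [+oo] of [- lne r] where [r] vanishes makes the bound on the limit also
    yield [P `<< P'] ([KL_le_of_mixtures]).

    The integrands need not be integrable a priori, but all are bounded below by
    minus an integrable function; [integralD_bounded_below] splits such integrals
    additively.  The converse also needs a prior and a Markov kernel of posteriors
    for every weight ([two_point_prior_posterior]). *)

(** * Integrals that may be infinite *)

Section Integrals.
Context {d : measure_display} {Y : measurableType d} {R : realType}.
Variable mu : {measure set Y -> \bar R}.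
Implicit Types f g : Y -> \bar R.

Lemma measurable_lne f : measurable_fun setT f ->
  measurable_fun setT (fun t => lne (f t)).
Proof.
move=> mf.
have -> : (fun t => lne (f t)) = fun t => if f t <= 0 then -oo else
    if +oo <= f t then +oo else (ln (fine (f t)))%:E.
  apply/funext => t; case: (f t) => [r| |] //=;
    by rewrite ?lee_fin ?leey ?leNye.
apply: measurable_fun_ifT => //; first exact: measurable_fun_lee.
apply: measurable_fun_ifT => //; first exact: measurable_fun_lee.
apply/measurable_EFinP; apply: measurableT_comp => //.
exact: measurableT_comp.
Qed.

(** The positive and the negative parts are compared separately, which allows
    infinite integrals. *)
Lemma ae_le_integral f g :
  measurable_fun setT f -> measurable_fun setT g ->
  {ae mu, forall t, f t <= g t} -> \int[mu]_t f t <= \int[mu]_t g t.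
Proof.
move=> mf mg fg; rewrite integralE [leRHS]integralE; apply: leeB.
- apply: ae_ge0_le_integral => //; try exact: measurable_funepos.
  apply: filterS fg => t fg _.
  by rewrite !funeposE ge_max !le_max lexx fg ?orbT.
- apply: ae_ge0_le_integral => //; try exact: measurable_funeneg.
  apply: filterS fg => t fg _.
  by rewrite !funenegE ge_max !le_max lexx leeN2 fg ?orbT.
Qed.

(** The negative part of [f] is dominated by [r], hence has a finite integral that
    can be cancelled in [(f + r) + f^\- = f^\+ + r], an identity between
    nonnegative functions.  The integral of [f] itself may be [+oo]. *)
Lemma integralD_bounded_below f (r : Y -> R) :
    measurable_fun setT f -> measurable_fun setT r ->
    (forall t, (0 <= r t)%R) -> \int[mu]_t (r t)%:E < +oo ->
    (forall t, 0 <= f t + (r t)%:E) ->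
  \int[mu]_t (f t + (r t)%:E) = \int[mu]_t f t + \int[mu]_t (r t)%:E.
Proof.
move=> mf mr r0 rfin fr0.
have mr' : measurable_fun setT (EFin \o r) by exact/measurable_EFinP.
have mfp : measurable_fun setT (f^\+) by exact: measurable_funepos.
have mfn : measurable_fun setT (f^\-) by exact: measurable_funeneg.
have fn_le t : f^\- t <= (r t)%:E.
  rewrite funenegE ge_max lee_fin r0 andbT.
  have := fr0 t; case: (f t) => [a| |]; rewrite /= ?leNye // ?lee_fin.
  by move=> h; lra.
have fn_fin : \int[mu]_t f^\- t \is a fin_num.
  rewrite ge0_fin_numE; last exact: integral_ge0.
  by apply: le_lt_trans rfin; apply: ge0_le_integral.
have rint : \int[mu]_t (r t)%:E \is a fin_num.
  by rewrite ge0_fin_numE//; apply: integral_ge0 => t _; rewrite lee_fin.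
have split2 : \int[mu]_t (f t + (r t)%:E) + \int[mu]_t f^\- t =
              \int[mu]_t f^\+ t + \int[mu]_t (r t)%:E.
  rewrite -!ge0_integralD //; last 2 first.
  - by move=> t _; rewrite lee_fin.
  - exact: emeasurable_funD.
  apply: eq_integral => t _.
  have fnt : f^\- t \is a fin_num.
    by rewrite ge0_fin_numE ?funeneg_ge0// (le_lt_trans (fn_le t)) ?ltry.
  rewrite {1}(funeposneg f).
  by rewrite addeAC subeK.
rewrite [in RHS]integralE addeAC -split2 addeK//.
Qed.

End Integrals.

(** * Densities and the divergence *)

Lemma measurable_ratio {d : measure_display} {Y : measurableType d}
    {R : realType} (f g : Y -> R) : (forall t, (0 <= g t)%R) ->
  measurable_fun setT f -> measurable_fun setT g ->
  measurable_fun setT (fun t => (f t / g t)%R).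
Proof.
move=> g0 mf mg; apply: measurable_funM => //.
rewrite (_ : (fun t => _) = (fun t => powR (g t) (-1))).
  by apply: (measurableT_comp (measurable_powR _)) => //.
by apply/funext => t; rewrite powR_inv1.
Qed.

Section Densities.
Context {d : measure_display} {Y : measurableType d} {R : realType}.
Variable mu : {sigma_finite_measure set Y -> \bar R}.
Implicit Types (P : probability Y R) (m : Y -> R).

Lemma density_dominates P m : is_density mu P m -> P `<< mu.
Proof.
move=> [mm m0 Pm]; apply/null_content_dominatesP => A mA muA.
rewrite Pm//; apply: null_set_integral => //.
exact/measurable_funTS/measurable_EFinP.
Qed.

Lemma density_ae_gt0 P m : is_density mu P m -> {ae P, forall t, (0 < m t)%R}.
Proof.
move=> [mm m0 Pm].
have mA : measurable [set t | (m t <= 0)%R].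
  by rewrite -preimage_itvNyc -[X in measurable X]setTI; exact: mm.
exists [set t | (m t <= 0)%R]; split => //; last first.
  by move=> t /= /negP; rewrite -leNgt.
rewrite Pm//; apply: integral0_eq => t /= mt0.
by congr _%:E; apply/eqP; rewrite eq_le mt0 m0.
Qed.

Lemma density_Radon_Nikodym P m : is_density mu P m ->
  ae_eq mu setT (Radon_Nikodym_SigmaFinite.f P mu) (EFin \o m).
Proof.
move=> /[dup] /density_dominates Pmu [mm m0 Pm].
apply: integral_ae_eq => //.
- exact: Radon_Nikodym_SigmaFinite.f_integrable.
- exact/measurable_EFinP.
- by move=> A _ mA; rewrite -Pm// -Radon_Nikodym_SigmaFinite.f_integral.
Qed.

Lemma ge0_integral_density P m (f : Y -> \bar R) : is_density mu P m ->
    (forall t, 0 <= f t) -> measurable_fun setT f ->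
  \int[P]_t f t = \int[mu]_t (f t * (m t)%:E).
Proof.
move=> dm f0 mf; have [mm m0 _] := dm; have Pmu := density_dominates dm.
rewrite -(Radon_Nikodym_SigmaFinite.change_of_variables Pmu)//.
apply: ae_eq_integral => //.
- apply: emeasurable_funM => //.
  exact: measurable_int (Radon_Nikodym_SigmaFinite.f_integrable _).
- by apply: emeasurable_funM => //; exact/measurable_EFinP.
- by apply: filterS (density_Radon_Nikodym dm) => t /= h _; rewrite h.
Qed.

(** The integral is the [P']-mass of the set where [m] is positive. *)
Lemma integral_density_ratio_le1 P P' m m' :
    is_density mu P m -> is_density mu P' m' ->
  \int[P]_t (m' t / m t)%:E <= 1.
Proof.
move=> dm dm'; have [mm m0 _] := dm; have [mm' m'0 Pm'] := dm'.
have mr : measurable_fun setT (fun t => (m' t / m t)%R).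
  exact: measurable_ratio.
rewrite (ge0_integral_density dm); last 2 first.
- by move=> t; rewrite lee_fin divr_ge0.
- exact/measurable_EFinP.
rewrite -(probability_setT P') Pm'//; apply: ge0_le_integral => //.
- by move=> t _; rewrite mule_ge0 // lee_fin ?divr_ge0.
- by apply: emeasurable_funM => //; exact/measurable_EFinP.
- exact/measurable_EFinP.
move=> t _; rewrite -EFinM lee_fin.
have [->|mt0] := eqVneq (m t) 0%R; first by rewrite mulr0.
by rewrite divfK.
Qed.

(** The chain rule [dP/dmu = dP/dP' * dP'/dmu] reads [m = dP/dP' * m'] almost
    everywhere, and [m] is positive [P]-almost everywhere. *)
Lemma Radon_Nikodym_density_ratio P P' m m' :
    is_density mu P m -> is_density mu P' m' -> P `<< P' ->
  {ae P, forall t, [/\ (0 < m t)%R, (0 < m' t)%R &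
    ('d (charge_of_finite_measure P) '/d P') t = (m t / m' t)%:E]}.
Proof.
move=> dm dm' PP'; have [mm m0 _] := dm; have [mm' m'0 _] := dm'.
have Pmu := density_dominates dm; have P'mu := density_dominates dm'.
have E1 := density_Radon_Nikodym dm.
have E2 := density_Radon_Nikodym dm'.
have E3 := ae_eq_Radon_Nikodym_SigmaFinite PP' measurableT.
have E4 := Radon_Nikodym_SigmaFinite.chain_rule PP' P'mu measurableT.
have {}E1 := null_dominates_ae_eq measurableT Pmu E1.
have {}E2 := null_dominates_ae_eq measurableT Pmu E2.
have {}E3 := null_dominates_ae_eq measurableT PP' E3.
have {}E4 := null_dominates_ae_eq measurableT Pmu E4.
near=> t.
have mt : (0 < m t)%R by near: t; exact: density_ae_gt0.
have E1t : Radon_Nikodym_SigmaFinite.f P mu t = (m t)%:E.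
  by near: t; apply: filterS E1 => t; exact.
have E2t : Radon_Nikodym_SigmaFinite.f P' mu t = (m' t)%:E.
  by near: t; apply: filterS E2 => t; exact.
have E3t : Radon_Nikodym_SigmaFinite.f P P' t =
    ('d (charge_of_finite_measure P) '/d P') t.
  by near: t; apply: filterS E3 => t; exact.
have E4t : (m t)%:E = Radon_Nikodym_SigmaFinite.f P P' t * (m' t)%:E.
  by rewrite -E1t -E2t; near: t; apply: filterS E4 => t; exact.
have m't : (0 < m' t)%R.
  rewrite lt_neqAle m'0 andbT eq_sym; apply/eqP => m't0.
  move: E4t; rewrite m't0 mule0 => -[].
  by move=> mt0; rewrite mt0 ltxx in mt.
split => //; rewrite -E3t; move: E4t.
have := Radon_Nikodym_SigmaFinite.f_fin_num PP' t.
case: (Radon_Nikodym_SigmaFinite.f _ _ _) => //= a _ [->].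
by rewrite mulfK// gt_eqF.
Unshelve. all: by end_near. Qed.

Lemma KL_density P P' m m' :
    is_density mu P m -> is_density mu P' m' -> P `<< P' ->
  KL P P' = \int[P]_t (ln (m t / m' t))%:E.
Proof.
move=> dm dm' PP'; have [mm m0 _] := dm; have [mm' m'0 _] := dm'.
rewrite /KL asboolT//; apply: ae_eq_integral => //.
- exact: measurable_lne.
- apply/measurable_EFinP; apply: measurableT_comp => //.
  exact: measurable_ratio.
- apply: filterS (Radon_Nikodym_density_ratio dm dm' PP') => t [mt m't ->] _.
  by rewrite lne_EFin// divr_gt0.
Qed.

(** On a [P']-null set, [m'] vanishes [mu]-almost everywhere, hence [P]-almost
    everywhere, so such a set is [P]-null if [m'] is [P]-almost surely positive. *)
Lemma dominates_density P P' m m' :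
    is_density mu P m -> is_density mu P' m' ->
  {ae P, forall t, (0 < m' t)%R} -> P `<< P'.
Proof.
move=> dm dm' m'_gt0; have [mm' m'0 Pm'] := dm'.
apply/null_content_dominatesP => A mA.
rewrite [X in X = _ -> _](Pm' A)// => int0.
have : ae_eq mu A (EFin \o m') (cst 0).
  apply/ae_eq_integral_abs => //.
    exact/measurable_funTS/measurable_EFinP.
  by rewrite -[RHS]int0; apply: eq_integral => t _ /=; rewrite ger0_norm.
move=> /(null_dominates_ae_eq mA (density_dominates dm)).
move=> /(filterI m'_gt0).
move=> [N [mN PN sN]]; apply/eqP; rewrite eq_le measure_ge0 andbT -PN.
apply: le_measure; rewrite ?inE// => t At; apply: sN => /= -[m't].
by move=> /(_ At)[m't0]; rewrite m't0 ltxx in m't.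
Qed.

End Densities.

Section CommonDensities.
Context {d : measure_display} {Y : measurableType d} {R : realType}.

Lemma density_exists (mu : {sigma_finite_measure set Y -> \bar R})
    (P : probability Y R) : P `<< mu -> exists m, is_density mu P m.
Proof.
move=> Pmu; pose f := Radon_Nikodym_SigmaFinite.f P mu.
have f_fin t : f t = (fine (f t))%:E.
  by rewrite fineK// Radon_Nikodym_SigmaFinite.f_fin_num.
exists (fine \o f); split.
- apply/measurable_EFinP; rewrite (_ : EFin \o _ = f).
    exact: measurable_int (Radon_Nikodym_SigmaFinite.f_integrable _).
  by apply/funext => t; rewrite /= -f_fin.
- by move=> t; rewrite fine_ge0// Radon_Nikodym_SigmaFinite.f_ge0.
- move=> A mA; rewrite (Radon_Nikodym_SigmaFinite.f_integral Pmu)//.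
  by apply: eq_integral => t _; rewrite -f_fin.
Qed.

(** The sum of the two measures dominates both. *)
Lemma common_density (P P' : probability Y R) :
  exists (mu : {sigma_finite_measure set Y -> \bar R}) (m m' : Y -> R),
    is_density mu P m /\ is_density mu P' m'.
Proof.
pose nu : {measure set Y -> \bar R} := measure_add P P'.
have nu_fin : fin_num_fun nu.
  by move=> A mA; rewrite [nu A]measure_addE fin_numD !fin_num_measure.
pose mu : {finite_measure set Y -> \bar R} :=
  HB.pack (Measure.sort nu) (Measure_isFinite.Build _ _ _ nu nu_fin).
have [m dm] : exists m, is_density mu P m.
  apply: density_exists; apply/null_content_dominatesP => A mA.
  rewrite [X in X = _ -> _]measure_addE => /eqP.
  by rewrite padde_eq0 ?measure_ge0// => /andP[/eqP].
have [m' dm'] : exists m', is_density mu P' m'.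
  apply: density_exists; apply/null_content_dominatesP => A mA.
  rewrite [X in X = _ -> _]measure_addE => /eqP.
  by rewrite padde_eq0 ?measure_ge0// => /andP[_ /eqP].
by exists mu, m, m'.
Qed.

End CommonDensities.

(** * Divergence from a mixture *)

Section Mixtures.
Context {d : measure_display} {Y : measurableType d} {R : realType}.
Variables (mu : {sigma_finite_measure set Y -> \bar R}).
Variables (P P' : probability Y R) (m m' : Y -> R).
Hypotheses (dm : is_density mu P m) (dm' : is_density mu P' m').

Let r t : R := (m' t / m t)%R.

Let mm : measurable_fun setT m. Proof. by case: dm. Qed.
Let mm' : measurable_fun setT m'. Proof. by case: dm'. Qed.
Let m_ge0 t : (0 <= m t)%R. Proof. by case: dm. Qed.
Let m'_ge0 t : (0 <= m' t)%R. Proof. by case: dm'. Qed.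
Let r_ge0 t : (0 <= r t)%R. Proof. exact: divr_ge0. Qed.
Let mr : measurable_fun setT r. Proof. exact: measurable_ratio. Qed.

Let rho := fine (\int[P]_t (r t)%:E).

Let rhoE : \int[P]_t (r t)%:E = rho%:E.
Proof.
rewrite fineK// ge0_fin_numE; last by apply: integral_ge0 => t _; rewrite lee_fin.
exact: le_lt_trans (integral_density_ratio_le1 dm dm') (ltry 1).
Qed.

Let mix_gt0 (w : R) t : (0 < w < 1)%R -> (0 < w + (1 - w) * r t)%R.
Proof.
move=> /andP[w0 w1]; apply: (lt_le_trans w0).
by rewrite lerDl mulr_ge0// subr_ge0 ltW.
Qed.

(** Concavity of [ln] bounds the integrand by [(1 - w) * ln (m / m')].  Adding [r]
    to [ln (m / m')] makes it nonnegative, since [ln r <= r], which allows the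
    factor [1 - w] to be moved out of the integral. *)
Lemma mixture_divergence_le (w e : R) : (0 < w < 1)%R -> (0 <= e)%R ->
  KL P P' <= e%:E -> \int[P]_t (- ln (w + (1 - w) * r t))%:E <= e%:E.
Proof.
move=> w01 e0 KLe; have /andP[w0 w1] := w01.
have PP' : P `<< P'.
  by apply: contrapT => nPP'; move: KLe; rewrite /KL asboolF// leye_eq.
have w1' : (0 <= 1 - w)%R by rewrite subr_ge0 ltW.
pose L t := ln (m t / m' t).
have mL : measurable_fun setT L.
  by apply: measurableT_comp => //; exact: measurable_ratio.
have mwr : measurable_fun setT (fun t => ((1 - w) * r t)%R).
  exact: measurable_funM.
have Lr t : (0 <= L t + r t)%R.
  (* Where a density vanishes, [r] and [L] are both [0], by the
     conventions [a / 0 = 0] and [ln 0 = 0]. *)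
  have [r0|r0] := eqVneq (r t) 0%R.
    rewrite /L -invf_div -/(r t) r0 invr0 ln0 ?addr0//.
  have rt : (0 < r t)%R by rewrite lt_neqAle eq_sym r0/=.
  rewrite /L -invf_div -/(r t) lnV ?posrE// addrC subr_ge0 ltW//.
  exact: ln_sublinear.
apply: (@le_trans _ _ (\int[P]_t ((1 - w) * L t)%:E)).
  apply: ae_le_integral.
  - apply/measurable_EFinP; apply: measurableT_comp => //.
    by apply: measurableT_comp => //; exact: measurable_funD.
  - by apply/measurable_EFinP; exact: measurable_funM.
  - apply: filterS (Radon_Nikodym_density_ratio dm dm' PP') => t [mt m't _].
    have rt : (0 < r t)%R by rewrite divr_gt0.
    rewrite lee_fin /L -invf_div -/(r t) lnV ?posrE// mulrN lerN2.
    have w_itv : Itv.spec (@Itv.num_sem R) (Itv.Real `[Posz 0, Posz 1]) w.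
      by rewrite /= /Itv.num_sem/= ger0_real ?ltW//= in_itv/= !ltW.
    have := @concave_ln R (Itv.mk w_itv) 1%R (r t) ltr01 rt.
    by rewrite !convRE/= ln1 mulr0 add0r mulr1.
have int_wL : \int[P]_t ((1 - w) * L t)%:E + ((1 - w) * rho)%:E =
    (1 - w)%:E * (KL P P' + rho%:E).
  rewrite (KL_density dm dm' PP') -rhoE -integralD_bounded_below//; last 2 first.
  - exact/measurable_EFinP.
  - by rewrite rhoE ltry.
  rewrite -ge0_integralZl_EFin//; last 2 first.
  - by move=> t _; rewrite -EFinD lee_fin Lr.
  - by apply: emeasurable_funD; exact/measurable_EFinP.
  have rhow : \int[P]_t ((1 - w) * r t)%:E = ((1 - w) * rho)%:E.
    rewrite EFinM -rhoE -ge0_integralZl_EFin//.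
    - by move=> t _; rewrite lee_fin.
    - exact/measurable_EFinP.
  rewrite -rhow -integralD_bounded_below//.
  - by apply: eq_integral => t _; rewrite -EFinD -EFinM mulrDr.
  - by apply/measurable_EFinP; exact: measurable_funM.
  - by move=> t; rewrite mulr_ge0.
  - by rewrite rhow ltry.
  - by move=> t; rewrite -EFinD lee_fin -mulrDr mulr_ge0.
rewrite -(leeD2rE _ _ (_ : ((1 - w) * rho)%:E \is a fin_num))// int_wL.
apply: (@le_trans _ _ ((1 - w)%:E * (e%:E + rho%:E))).
  by rewrite lee_wpmul2l ?lee_fin// leeD2r.
rewrite -!EFinD -EFinM lee_fin mulrDr lerD2r ler_piMl// lerBlDr lerDl.
exact: ltW.
Qed.

Let u (w : R) t : \bar R := (- ln (w + (1 - w) * r t))%:E.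

Let measurable_u w : measurable_fun setT (u w).
Proof.
apply/measurable_EFinP; apply: measurableT_comp => //.
apply: measurableT_comp => //; apply: measurable_funD => //.
exact: measurable_funM.
Qed.

Let u_ge0 (w : R) t : (0 < w < 1)%R -> 0 <= u w t + (r t)%:E.
Proof.
move=> w01; have /andP[w0 w1] := w01; rewrite -EFinD lee_fin addrC subr_ge0.
have := mix_gt0 t w01; set c := (_ + _)%R => c0.
(* [ln c <= c - 1], and [c - 1 <= r] because [0 < w < 1] and [0 <= r]. *)
have : (ln (1 + (c - 1)) <= c - 1)%R by apply: le_ln1Dx; lra.
rewrite addrC subrK => /le_trans; apply.
by rewrite /c; have := r_ge0 t; nra.
Qed.

Let cvg_u t : (u (n.+2%:R^-1)%R t + (r t)%:E) @[n --> \oo] -->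
  - lne (r t)%:E + (r t)%:E.
Proof.
have w0 : (n.+2%:R^-1 : R)%R @[n --> \oo] --> (0 : R)%R.
  by have := @cvg_harmonic R; rewrite -(cvg_shiftS (@harmonic R)).
apply: cvgeD; [by rewrite fin_num_adde_defl| |exact: cvg_cst].
have [r0|r0] := eqVneq (r t) 0%R.
  rewrite r0 le0_lneNy//=; apply/cvgeyPge => A.
  near=> n; rewrite /u r0 mulr0 addr0 lee_fin lerNr -ler_expR lnK ?posrE//.
  near: n; apply: (cvgr_le _ w0); exact: expR_gt0.
have rt : (0 < r t)%R by rewrite lt_neqAle eq_sym r0/=.
rewrite lne_EFin// -EFinN; apply: cvg_EFin; first exact: nearW.
apply: cvgN; apply: (continuous_cvg _ (continuous_ln rt)).
rewrite -[X in _ --> X](_ : 0 + (1 - 0) * r t = r t)%R; last first.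
  by rewrite subr0 mul1r add0r.
by apply: cvgD => //; apply: cvgM; [apply: cvgB => //|]; exact: cvg_cst.
Unshelve. all: by end_near. Qed.

(** Fatou's lemma is applied along [w = 1 / (n + 2)], the shift keeping every
    weight inside the open unit interval.  The same term, the integral of [r], is
    added to both sides of the bound and cancelled at the end. *)
Lemma KL_le_of_mixtures (e : R) :
  (forall w : R, (0 < w < 1)%R ->
    \int[P]_t (- ln (w + (1 - w) * r t))%:E <= e%:E) ->
  KL P P' <= e%:E.
Proof.
move=> mix_le.
have w01 n : (0 < (n.+2%:R^-1 : R)%R < 1)%R.
  by rewrite invr_gt0 ltr0n/= invf_lt1 ?ltr0n// ltr1n.
pose h n t : \bar R := u (n.+2%:R^-1)%R t + (r t)%:E.
pose hoo t : \bar R := - lne (r t)%:E + (r t)%:E.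
have mh n : measurable_fun setT (h n).
  by apply: emeasurable_funD => //; exact/measurable_EFinP.
have mlner : measurable_fun setT (fun t => - lne (r t)%:E).
  by apply: measurableT_comp => //; apply/measurable_lne/measurable_EFinP.
have mhoo : measurable_fun setT hoo.
  by apply: emeasurable_funD => //; exact/measurable_EFinP.
have hoo_ge0 t : 0 <= hoo t.
  have [r0|r0] := eqVneq (r t) 0%R; first by rewrite /hoo r0 le0_lneNy//= leey.
  have rt : (0 < r t)%R by rewrite lt_neqAle eq_sym r0/=.
  rewrite /hoo lne_EFin// -EFinN -EFinD lee_fin addrC subr_ge0 ltW//.
  exact: ln_sublinear.
have int_h n : \int[P]_t h n t <= (e + rho)%:E.
  rewrite integralD_bounded_below//; last 2 first.
  - by rewrite rhoE ltry.
  - by move=> t; exact: u_ge0.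
  by rewrite rhoE EFinD leeD2r// mix_le.
have int_hoo : \int[P]_t hoo t <= (e + rho)%:E.
  have -> : \int[P]_t hoo t = \int[P]_t limn_einf (fun n => h n t).
    by apply: eq_integral => t _; rewrite (cvg_limn_einf_sup (@cvg_u t)).
  apply: le_trans (fatou _ _ _ _) _ => //.
    by move=> n t _; exact: u_ge0.
  rewrite limn_einf_lim; apply: lime_le; first exact: is_cvg_einfs.
  apply: nearW => n; apply: le_trans (int_h n).
  by apply: ereal_inf_lbound; exists n => /=.
(* [hoo] is [+oo] where [m'] vanishes, but its integral is finite. *)
have m'_gt0 : {ae P, forall t, (0 < m' t)%R}.
  have hoo_int : P.-integrable setT hoo.
    apply/integrableP; split => //.
    under eq_integral do rewrite gee0_abs//.
    exact: le_lt_trans int_hoo (ltry _).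
  apply: filterS2 (density_ae_gt0 dm) (integrable_ae measurableT hoo_int).
  move=> t mt /(_ I) hfin.
  rewrite lt_neqAle m'_ge0 andbT eq_sym; apply/eqP => m't.
  by move: hfin; rewrite /hoo /r m't mul0r le0_lneNy.
have PP' := dominates_density dm dm' m'_gt0.
rewrite (KL_density dm dm' PP').
have -> : \int[P]_t (ln (m t / m' t))%:E = \int[P]_t - lne (r t)%:E.
  apply: ae_eq_integral => //.
    apply/measurable_EFinP; apply: measurableT_comp => //.
    exact: measurable_ratio.
  apply: filterS2 (density_ae_gt0 dm) m'_gt0 => t mt m't _.
  by rewrite -invf_div -/(r t) lne_EFin ?divr_gt0// lnV ?posrE ?divr_gt0.
rewrite -(leeD2rE _ _ (_ : rho%:E \is a fin_num))// -EFinD.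
by rewrite -rhoE -integralD_bounded_below// rhoE ltry.
Qed.

End Mixtures.

Lemma KL_refl {d : measure_display} {Y : measurableType d} {R : realType}
  (P : probability Y R) : KL P P = 0.
Proof.
have [mu [m [_ [dm _]]]] := common_density P P.
rewrite (KL_density dm dm)//; apply: integral0_eq => t _.
have [->|mt] := eqVneq (m t) 0%R; first by rewrite mul0r ln0.
by rewrite divff// ln1.
Qed.

(** * The expected score gap *)

Section ScoreGap.
Context {dX dY : measure_display} {X : measurableType dX}
  {Y : measurableType dY} {R : realType}.

(** The convention for equal infinite scores is void here, as the prior score is
    finite. *)
Lemma log_score_gapE (Q Q' : probability X R) (x : X) (w : R) :
  (0 < w)%R -> Q [set x] = w%:E ->
  score_gap log_score Q Q' x = lne (Q' [set x]) - (ln w)%:E.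
Proof.
move=> w0 Qx; rewrite /score_gap /log_score Qx lne_EFin//.
case: ifPn => [/eqP/oppe_inj <-|_]; first by rewrite subee.
by rewrite oppeK addeC.
Qed.

Lemma expected_log_score_gap (mu : {sigma_finite_measure set Y -> \bar R})
    (P P' : probability Y R) (m m' : Y -> R) (Q : probability X R)
    (QT : R.-pker Y ~> X) (x : X) (w : R) :
  measurable [set x] -> (0 < w < 1)%R -> Q [set x] = w%:E ->
  is_density mu P m -> is_density mu P' m' ->
  (forall t, (0 < m t * w + m' t * (1 - w))%R ->
    QT t [set x] = (m t * w / (m t * w + m' t * (1 - w)))%:E) ->
  \int[P]_t score_gap log_score Q (kernel_at QT t) x =
  \int[P]_t (- ln (w + (1 - w) * (m' t / m t)))%:E.
Proof.
move=> mx /andP[w0 w1] Qx dm dm' QTx.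
have [mm m_ge0 _] := dm; have [mm' m'_ge0 _] := dm'.
under eq_integral do rewrite (log_score_gapE _ w0 Qx).
apply: ae_eq_integral => //.
- apply: emeasurable_funB => //; apply: measurable_lne.
  exact: measurable_kernel.
- apply/measurable_EFinP; apply: measurableT_comp => //.
  apply: measurableT_comp => //; apply: measurable_funD => //.
  by apply: measurable_funM => //; exact: measurable_ratio.
apply: filterS (density_ae_gt0 dm) => t mt _.
have c0 : (0 < m t * w + m' t * (1 - w))%R.
  by apply: ltr_pwDl; rewrite ?mulr_gt0 ?mulr_ge0 ?subr_ge0 ?(ltW w1).
rewrite [X in lne X](_ : _ = (m t * w / (m t * w + m' t * (1 - w)))%:E);
  last exact: QTx.
rewrite lne_EFin ?divr_gt0 ?mulr_gt0//.
have -> : (w + (1 - w) * (m' t / m t) = (m t * w + m' t * (1 - w)) / m t)%R.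
  by field; rewrite gt_eqF.
rewrite !ln_div ?posrE ?mulr_gt0// lnM ?posrE// -EFinB; congr _%:E.
by ring.
Qed.

End ScoreGap.

(** * Two-point priors and their posteriors *)

Section TwoPointKernel.
Context {dX dY : measure_display} {X : measurableType dX}
  {Y : measurableType dY} {R : realType}.
Variables (x x' : X) (p : Y -> R).
Hypotheses (mp : measurable_fun setT p) (p01 : forall t, (0 <= p t <= 1)%R).

Let p_ge0 t : (0 <= p t)%R. Proof. by case/andP: (p01 t). Qed.
Let onem_p_ge0 t : (0 <= 1 - p t)%R.
Proof. by rewrite subr_ge0; case/andP: (p01 t). Qed.

(** The measurability proof is an argument so that the kernel structure can be
    inferred from the term. *)
Definition two_point_kernel (_ : measurable_fun setT p) (t : Y) :
    {measure set X -> \bar R} :=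
  measure_add (mscale (NngNum (p_ge0 t)) \d_x)
              (mscale (NngNum (onem_p_ge0 t)) \d_x').

Lemma two_point_kernelE t A : two_point_kernel mp t A =
  (p t)%:E * \d_x A + (1 - p t)%:E * \d_x' A.
Proof. exact: measure_addE. Qed.

Let measurable_two_point_kernel U : measurable U ->
  measurable_fun setT (two_point_kernel mp ^~ U).
Proof.
move=> mU; under eq_fun do rewrite two_point_kernelE.
by apply: emeasurable_funD; apply: emeasurable_funM => //;
  apply/measurable_EFinP => //; exact: measurable_funB.
Qed.

HB.instance Definition _ := isKernel.Build _ _ _ _ _ (two_point_kernel mp)
  measurable_two_point_kernel.

Let two_point_kernel_setT t : two_point_kernel mp t setT = 1.
Proof. by rewrite two_point_kernelE !diracT !mule1 -EFinD addrC subrK. Qed.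

HB.instance Definition _ := Kernel_isProbability.Build _ _ _ _ _
  (two_point_kernel mp) two_point_kernel_setT.

End TwoPointKernel.

(** A set of full mass contains both atoms, so an enumeration of such a pair is an
    enumeration of the atoms. *)
Lemma two_point_prior_support {d : measure_display} {X : measurableType d}
    {R : realType} (Q : probability X R) :
  (forall x : X, measurable [set x]) -> two_point_priors Q ->
  exists y y' : X, [/\ y <> y', (forall z, Q [set z] != 0 -> z = y \/ z = y') &
    (forall a b, Q [set a; b] = 1 -> (a = y /\ b = y') \/ (a = y' /\ b = y))].
Proof.
move=> mpt [y [y' [v [v' [yy' v0 v'0 vv' QE]]]]]; exists y, y'; split => //.
- move=> z; rewrite QE// !diracE => Qz; apply: contrapT => /not_orP[zy zy'].
  move: Qz; rewrite !memNset/= ?mule0 ?adde0 ?eqxx// => e; [exact: zy'|exact: zy].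
- move=> a b Qab.
  have mab : measurable [set a; b] by exact: measurableU.
  have yab : [set a; b] y.
    apply: contrapT => nyab; move: Qab; rewrite QE// !diracE memNset// mule0 add0e.
    case: (_ \in _) => /=; rewrite -EFinM => -[]; lra.
  have y'ab : [set a; b] y'.
    apply: contrapT => nyab; move: Qab.
    rewrite QE// !diracE [y' \in _]memNset// mule0 adde0.
    case: (_ \in _) => /=; rewrite -EFinM => -[]; lra.
  by case: yab y'ab yy' => /= -> [] /= -> yy'; [case: yy'|left|right|case: yy'].
Qed.

Section TwoPointPosterior.
Context {dX dY : measure_display} {X : measurableType dX}
  {Y : measurableType dY} {R : realType}.
Variables (M : R.-pker X ~> Y) (nbr : X -> X -> Prop).

(** The quotient of Bayes' formula serves as posterior weight of [x] at every
    output: where its denominator vanishes it is [0], a valid weight. *)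
Lemma two_point_prior_posterior (mu : {sigma_finite_measure set Y -> \bar R})
    (x x' : X) (m m' : Y -> R) (w : R) :
  nbr x x' -> x <> x' -> (0 < w < 1)%R ->
  is_density mu (kernel_at M x) m -> is_density mu (kernel_at M x') m' ->
  exists (Q : probability X R) (QT : R.-pker Y ~> X),
    [/\ neighbour_priors nbr Q, is_posterior M Q QT, Q [set x] = w%:E &
      forall t, (0 < m t * w + m' t * (1 - w))%R ->
        QT t [set x] = (m t * w / (m t * w + m' t * (1 - w)))%:E].
Proof.
move=> xx' neq w01 dm dm'; have /andP[w0 w1] := w01.
have [mm m_ge0 _] := dm; have [mm' m'_ge0 _] := dm'.
have a_ge0 t : (0 <= m t * w)%R by rewrite mulr_ge0// ltW.
have b_ge0 t : (0 <= m' t * (1 - w))%R by rewrite mulr_ge0// subr_ge0 ltW.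
have dirac_x : \d_x [set x'] = 0 :> \bar R by rewrite diracE memNset.
have dirac_x' : \d_x' [set x] = 0 :> \bar R.
  by rewrite diracE memNset// => /esym.
have dirac_xx z : \d_z [set z] = 1 :> \bar R by rewrite diracE mem_set.
pose p t : R := (m t * w / (m t * w + m' t * (1 - w)))%R.
have mp : measurable_fun setT p.
  apply: measurable_ratio; first by move=> t; rewrite addr_ge0.
    exact: measurable_funM.
  by apply: measurable_funD; exact: measurable_funM.
have p01 t : (0 <= p t <= 1)%R.
  rewrite /p divr_ge0 ?addr_ge0//=.
  have := addr_ge0 (a_ge0 t) (b_ge0 t); rewrite le_eqVlt => /predU1P[<-|c0].
    by rewrite invr0 mulr0.
  by rewrite ler_pdivrMr// mul1r lerDl.
have w01' (_ : X) : (0 <= w <= 1)%R by rewrite !ltW.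
pose K : R.-pker X ~> X := two_point_kernel x x' w01' (measurable_cst w).
pose Q : probability X R := kernel_at K x.
pose QT : R.-pker Y ~> X := two_point_kernel x x' p01 mp.
have QE A : Q A = w%:E * \d_x A + (1 - w)%:E * \d_x' A.
  exact: two_point_kernelE.
have QTE t A : QT t A = (p t)%:E * \d_x A + (1 - p t)%:E * \d_x' A.
  exact: two_point_kernelE.
have Qx : Q [set x] = w%:E by rewrite QE dirac_xx dirac_x' mule1 mule0 adde0.
have Qxx' : Q [set x; x'] = 1.
  by rewrite QE !diracE !mem_set; [rewrite !mule1 -EFinD addrC subrK|right|left].
have QTx t : QT t [set x] = (p t)%:E.
  by rewrite QTE dirac_xx dirac_x' mule1 mule0 adde0.
have w1' : (0 < 1 - w)%R by rewrite subr_gt0.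
exists Q, QT; split => //.
- split; last by exists x, x'.
  exists x, x', w, (1 - w)%R; split => //.
  by rewrite addrC subrK.
- split.
    exists x, x', mu, m, m'; rewrite Qx; split => // t c c0.
    split; first exact: QTx.
    rewrite QTE dirac_x dirac_xx mule1 mule0 add0e; congr _%:E.
    by move: c0; rewrite /p /c /= => c0; field; rewrite gt_eqF.
  move=> y Qy t; have [xy x'y] : x <> y /\ x' <> y.
    split => zy; move: Qy; rewrite -zy.
      by rewrite Qx => -[w_eq0]; rewrite w_eq0 ltxx in w0.
    rewrite QE dirac_x dirac_xx mule0 mule1 add0e => -[w_eq0].
    by rewrite w_eq0 ltxx in w1'.
  by rewrite QTE !diracE !memNset// !mule0 adde0.
Qed.

End TwoPointPosterior.

(** * The equivalence *)

Section Equivalence.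
Context {dX dY : measure_display} {X : measurableType dX}
  {Y : measurableType dY} {R : realType}.
Hypothesis measurable_point : forall x : X, measurable [set x].
Variables (nbr : X -> X -> Prop) (M : R.-pker X ~> Y) (eps : R).
Hypothesis nbr_sym : forall x x', nbr x x' -> nbr x' x.
Hypothesis eps_ge0 : (0 <= eps)%R.

(** If [x] is not an atom of the prior, the prior and posterior scores are both
    [+oo] and the gap is [0] by convention.  Otherwise the pair of points in
    Bayes' formula consists of the two atoms, which are neighbours. *)
Lemma PPE_of_RDP1 : RDP1 M nbr eps ->
  PPE M log_score (neighbour_priors nbr) id eps.
Proof.
move=> rdp.
have KL_le x x' : nbr x x' -> KL (kernel_at M x) (kernel_at M x') <= eps%:E.
  move=> xx'; apply: le_trans rdp; apply: ereal_sup_ubound.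
  by exists x', x; split => //; exact: nbr_sym.
apply: ge_ereal_sup => _ [x [Q [QT [[Qpri [z [z' [zz' Qzz']]]] Qpost ->]]]].
have [[x0 [x0' [mu [m [m' [/= w01 Qx0x0' dm dm' QTE]]]]]] Q0] := Qpost.
have [y [y' [neq Qsupp Qpair]]] := two_point_prior_support measurable_point Qpri.
have [Qx|Qx] := eqVneq (Q [set x]) 0.
  rewrite integral0_eq ?lee_fin// => t _.
  have QTx : (kernel_at QT t : probability X R) [set x] = 0 := Q0 _ Qx t.
  by rewrite /score_gap /log_score Qx QTx eqxx.
set w := fine (Q [set x0]) in w01 QTE.
have /andP[w0 w1] := w01.
have Qx0 : Q [set x0] = w%:E by rewrite fineK// fin_num_measure.
have [nx0 x0x0' xx0] : [/\ nbr x0 x0', x0 <> x0' & x = x0 \/ x = x0'].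
  have := Qsupp _ Qx.
  have [[? ?]|[? ?]] := Qpair _ _ Qzz'; have [[? ?]|[? ?]] := Qpair _ _ Qx0x0';
    subst; split => //; by [exact: nbr_sym|apply/nesym|tauto].
case: xx0 => ->.
  rewrite (expected_log_score_gap _ w01 Qx0 dm dm')//.
    by apply: (mixture_divergence_le dm dm') => //; exact: KL_le.
  by move=> t /QTE[].
have Qx0' : Q [set x0'] = (1 - w)%:E.
  have : Q [set x0] + Q [set x0'] = 1.
    rewrite -Qx0x0' measureU//.
    by apply/seteqP; split => // _ [-> /x0x0'].
  by rewrite Qx0 => eq1; rewrite EFinB -eq1 addeAC subee ?add0e.
(* Here [x] is the second point of the pair: the roles of [m] and [m'] are
   exchanged and the weight is [1 - w]. *)
have onem_w01 : (0 < 1 - w < 1)%R by lra.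
have wE : (w = 1 - (1 - w))%R by lra.
rewrite (expected_log_score_gap _ onem_w01 Qx0' dm' dm)//.
  by apply: (mixture_divergence_le dm' dm) => //; apply: KL_le; exact: nbr_sym.
by move=> t; rewrite -wE addrC => /QTE[].
Qed.

(** No two-point prior tests a pair [x, x] of equal neighbours, whose divergence
    is [0]. *)
Lemma RDP1_of_PPE : PPE M log_score (neighbour_priors nbr) id eps ->
  RDP1 M nbr eps.
Proof.
move=> ppe.
apply: ge_ereal_sup => _ [x' [x [xx' ->]]].
have [->|neq] := pselect (x = x'); first by rewrite KL_refl lee_fin.
have [mu [m [m' [dm dm']]]] := common_density (kernel_at M x) (kernel_at M x').
apply: (KL_le_of_mixtures dm dm') => w w01.
have [Q [QT [Qpri Qpost Qx QTx]]] :=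
  two_point_prior_posterior (nbr_sym xx') neq w01 dm dm'.
rewrite -(expected_log_score_gap _ w01 Qx dm dm' QTx)//.
apply: le_trans ppe; apply: ereal_sup_ubound.
by exists x, Q, QT; split.
Qed.

End Equivalence.

Local Close Scope charge_scope.
Local Close Scope ereal_scope.

Theorem proposition11 (R : realType) (dX dY : measure_display)
    (X : measurableType dX) (Y : measurableType dY)
    (measurable_point : forall x : X, measurable [set x])
    (nbr : X -> X -> Prop) (nbr_sym : forall x x', nbr x x' -> nbr x' x)
    (M : R.-pker X ~> Y) (eps : R) (eps_ge0 : 0 <= eps) :
  RDP1 M nbr eps <-> PPE M log_score (neighbour_priors nbr) id eps.
Proof. by split; [exact: PPE_of_RDP1|exact: RDP1_of_PPE]. Qed.
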